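(* Let $n\ge 2$ and let $M$ be an $n$-dimensional spacelike hypersurface with constant mean curvature $H$ in the Lorentzian product $\mathbb{H}^n\times\mathbb{R}$, foliated by $(n-1)$-dimensional spheres in parallel horizontal hyperplanes. If either $H\neq 0$, or $H=0$ and $n\geq 3$, then $M$ is rotationally symmetric.
   Context: $\mathbb{H}^n=\{(x_1,\dots,x_n)\in\mathbb{R}^n : x_n>0\}$ is the upper half-space model of hyperbolic space with metric $ds^2=\frac{(dx_1)^2+\cdots+(dx_n)^2}{x_n^2}$. The Lorentzian product $\mathbb{H}^n\times\mathbb{R}$ carries the Lorentzian metric $\langle\cdot,\cdot\rangle = ds^2-dt^2$, where $t$ is the coordinate on $\mathbb{R}$. A hypersurface $M$ is spacelike if the induced metric on $M$ is Riemannian; if $M$ is locally the level set of a smooth function $f$ (with nonvanishing gradient), this means $\nabla f$ is timelike along $M$: $\langle\nabla f,\nabla f\rangle<0$. The parallel horizontal hyperplanes are the slices $\mathbb{H}^n\times\{t\}$, $t\in\mathbb{R}$. $M$ is foliated by spheres in parallel horizontal hyperplanes if $M$ is a smooth one-parameter family, with $t$ ranging over an interval $I\subset\mathbb{R}$, of $(n-1)$-dimensional spheres $M\cap(\mathbb{H}^n\times\{t\})$, $t\in I$, each being a hyperbolic geodesic sphere (of positive radius) in $\mathbb{H}^n\times\{t\}$ (circles when $n=2$); in the upper half-space model these are exactly the Euclidean round spheres contained in $\{x_n>0\}$. Mean curvature: where the spacelike hypersurface $M$ is locally the level set of a smooth function $f$, oriented by the unit normal $N=-\nabla f/|\nabla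 f|$ with $|\nabla f|=\sqrt{-\langle\nabla f,\nabla f\rangle}$, the mean curvature $H$ is given by $nH=-\operatorname{div}\frac{\nabla f}{|\nabla f|}$, where $\nabla$ and $\operatorname{div}$ are the gradient and divergence with respect to the Lorentzian metric. $M$ (foliated by the spheres $M\cap(\mathbb{H}^n\times\{t\})$, $t\in I$, in parallel horizontal hyperplanes) is rotationally symmetric if the hyperbolic centers of all the spheres $M\cap(\mathbb{H}^n\times\{t\})$ lie on a single vertical geodesic $\{p\}\times\mathbb{R}$, $p\in\mathbb{H}^n$ (the rotation axis); equivalently, $M$ is invariant under all rotations of $\mathbb{H}^n$ about $p$ acting on the first factor. *)

(* Defs.v *)
From mathcomp Require Import all_boot all_order all_algebra.
From mathcomp Require Import all_classical all_reals all_analysis.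
Set Implicit Arguments.
Unset Strict Implicit.
Unset Printing Implicit Defensive.
Import Order.TTheory GRing.Theory Num.Theory.
Import numFieldNormedType.Exports.
Local Open Scope classical_set_scope.
Local Open Scope ring_scope.

(** * Semi-Riemannian calculus in one coordinate chart

    A metric on (an open subset of) R^N is given by its matrix
    [g : 'rV_N -> 'M_N] in the coordinate frame; vector fields are given by
    their components in that frame. *)
Section Chart.
Variables (R : realType) (N : nat).
Implicit Types (f : 'rV[R]_N -> R) (g : 'rV[R]_N -> 'M[R]_N).

Definition partial (i : 'I_N) f : 'rV[R]_N -> R :=
  fun z => derive f z (delta_mx 0 i).

(* C^oo on U: every iterated partial derivative is (Frechet) differentiable
   on U, hence also continuous there. *)
Definition smooth_on (U : set 'rV[R]_N) f :=
  forall (s : seq 'I_N) z, U z -> differentiable (foldr partial f s) z.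

Definition inner g (z u v : 'rV[R]_N) : R := (u *m g z *m v^T) 0 0.

(* (grad f)^i = \sum_j g^ij d_j f *)
Definition grad g f (z : 'rV[R]_N) : 'rV[R]_N :=
  (\row_j partial j f z) *m invmx (g z).

Definition vol_density g (z : 'rV[R]_N) : R := Num.sqrt `|\det (g z)|.

(* div X = |det g|^(-1/2) \sum_i d_i (|det g|^(1/2) X^i) *)
Definition divergence g (X : 'rV[R]_N -> 'rV[R]_N) (z : 'rV[R]_N) : R :=
  (vol_density g z)^-1 *
  \sum_i partial i (fun w => vol_density g w * X w 0 i) z.

End Chart.

(** * Hyperbolic space

    H^d, d = n.+1, is the upper half-space of ['rV[R]_n.+1]; the coordinate
    x_d is the last one.  The norm [`| x |] of a row vector is the sup norm,
    hence the explicit Euclidean [sqnorm]. *)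
Section Hyperbolic.
Variables (R : realType) (n : nat).
Implicit Types x y p : 'rV[R]_n.+1.

Definition height x : R := x 0 ord_max.

Definition half_space : set 'rV[R]_n.+1 := [set x | 0 < height x].

Definition sqnorm x : R := \sum_i x 0 i ^+ 2.

Definition arcosh (s : R) : R := ln (s + Num.sqrt (s ^+ 2 - 1)).

(* distance of the metric (dx_1^2 + ... + dx_d^2) / x_d^2 *)
Definition hdist x y : R :=
  arcosh (1 + sqnorm (x - y) / (2 * height x * height y)).

Definition geodesic_sphere p (r : R) : set 'rV[R]_n.+1 :=
  [set x | half_space x /\ hdist p x = r].

End Hyperbolic.

(** * The Lorentzian product H^d x R, d = n.+1

    A point (x, t) is the row vector [row_mx x (const_mx t)]. *)
Section Product.
Variables (R : realType) (n : nat).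
Local Notation point := 'rV[R]_(n.+1 + 1).
Implicit Types (M U : set point) (f : point -> R) (z w : point)
  (nu : point -> point).

Definition space_part z : 'rV[R]_n.+1 := lsubmx z.
Definition time_part z : R := rsubmx z 0 0.
Definition mkpoint (x : 'rV[R]_n.+1) (t : R) : point := row_mx x (const_mx t).

Definition HxR : set point := [set z | half_space (space_part z)].

Definition lorentz z : 'M[R]_(n.+1 + 1) :=
  block_mx ((height (space_part z) ^- 2)%:M) 0 0 (- 1%:M).

Definition local_level_set M U f :=
  [/\ open U, U `<=` HxR, smooth_on U f,
      forall z, (M `&` U) z -> grad lorentz f z != 0
    & exists c : R, M `&` U = [set z | U z /\ f z = c]].

Definition hypersurface M :=
  forall z, M z -> exists U f, U z /\ local_level_set M U f.

Definition spacelike M :=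
  forall U f, local_level_set M U f ->
  forall z, (M `&` U) z ->
  inner lorentz z (grad lorentz f z) (grad lorentz f z) < 0.

(* grad f / |grad f|, where |grad f| = sqrt (- <grad f, grad f>) *)
Definition unit_grad f z : point :=
  (Num.sqrt (- inner lorentz z (grad lorentz f z) (grad lorentz f z)))^-1
    *: grad lorentz f z.

Definition orientation M nu :=
  {within M, continuous nu} /\
  forall U f, local_level_set M U f ->
  forall z, (M `&` U) z -> nu z = unit_grad f z \/ nu z = - unit_grad f z.

(* The value of the mean curvature does not depend on the choice of f among
   the local defining functions inducing the given unit normal; such an f
   exists near every point of an oriented spacelike hypersurface.  The factor
   n.+1 is the dimension d of M. *)
Definition has_mean_curvature M nu (H : R) :=
  forall U f, local_level_set M U f ->
  (forall z, (M `&` U) z -> nu z = - unit_grad f z) ->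
  forall z, (M `&` U) z -> n.+1%:R * H = - divergence lorentz (unit_grad f) z.

Definition constant_mean_curvature M (H : R) :=
  exists nu, orientation M nu /\ has_mean_curvature M nu H.

Definition slice M (t : R) : set 'rV[R]_n.+1 := [set x | M (mkpoint x t)].

Definition smooth_curve_on (V : normedModType R) (J : set R) (c : R -> V) :=
  forall k t, J t -> derivable (derive1n k c) t 1.

(* The interval I may contain its endpoints, so smoothness on I means
   smoothness on an open neighbourhood J of I. *)
Definition foliated_by_spheres M (I : set R) :=
  (forall z, M z -> I (time_part z)) /\
  exists (J : set R) (p : R -> 'rV[R]_n.+1) (r : R -> R),
    [/\ open J, I `<=` J, smooth_curve_on J p, smooth_curve_on J r
      & forall t, I t -> [/\ half_space (p t), 0 < r t
                           & slice M t = geodesic_sphere (p t) (r t)]].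

Definition rotationally_symmetric M (I : set R) :=
  exists p : 'rV[R]_n.+1, half_space p /\
  forall t, I t -> exists2 r : R, 0 < r & slice M t = geodesic_sphere p r.

End Product.

(* Main.v *)
Require Import Defs.
From mathcomp Require Import all_boot all_order all_algebra.
From mathcomp Require Import all_classical all_reals all_analysis.
From mathcomp Require Import ring lra.
Import Order.TTheory GRing.Theory Num.Theory.
Import numFieldNormedType.Exports.
Local Open Scope classical_set_scope.
Local Open Scope ring_scope.

(** A geodesic sphere with center [p] and radius [r] is the Euclidean sphere
    with center [c] and squared radius [rho], where [c] is [p] with its height
    [h] replaced by [a = h cosh r], and [rho = (h sinh r) ^ 2].  So [M] is the
    zero set of [F (x, t) = |x - c(t)|^2 - rho(t)].  Put [L = F_t], [K = F_tt]
    (affine functions of [x]), [y] the height of [x] and [d = m + 2] the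
    dimension of [H^d].  On [M] the equation of constant mean curvature becomes
    [4 y^2 Q^2 = (d H)^2 (L^2 - 4 rho y^2)^3], where
    [Q = (d-2) a L^2 - 2 rho' y L - 4 (d-1) a rho y^2 + 2 rho y K].
    On a circle cut out of the sphere by a vertical plane through its center
    this is a polynomial identity, hence it persists at the two complex
    points of the circle with [y = 0], where it reduces to [d H L^3 = 0], or to
    [(d-2) a L^2 = 0] if [H = 0].  Thus [L] is a multiple of [y], which says
    exactly that the derivatives of the horizontal part of [p] and of [h^2 = a^2 - rho]
    vanish. *)

Set Implicit Arguments.
Unset Strict Implicit.

(** * Polynomial identities on a circle *)

(** A nonzero polynomial has fewer roots than its size, while the points [a + (b - a) / k.+2] give
    as many distinct roots as wanted; the shift to [k.+2] keeps them strictly below [b]. *)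
Lemma poly_eq0_on_interval (R : realFieldType) (p : {poly R}) (a b : R) :
  a < b -> (forall y, a < y < b -> p.[y] = 0) -> p = 0.
Proof.
move=> ab p0; apply/eqP/negPn/negP => pN0.
pose f (k : nat) : R := a + (b - a) / k.+2%:R.
have fI : injective f.
  move=> i j /addrI /mulfI; rewrite subr_eq0 gt_eqF// => /(_ isT)/invr_inj/eqP.
  by rewrite eqr_nat => /eqP[].
have rf : all (root p) [seq f i | i <- iota 0 (size p)].
  apply/allP => _ /mapP[k _ ->]; apply/rootP/p0.
  have ba : 0 < b - a by rewrite subr_gt0.
  rewrite /f ltrDl divr_gt0//= -ltrBrDl ltr_pdivrMr// ltr_pMr//.
  by rewrite ltr1n.
have := max_poly_roots pN0 rf; rewrite map_inj_uniq// iota_uniq size_map size_iota ltnn.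
by move=> /(_ isT).
Qed.

Lemma circle_rigidity (R : rcfType) (m : nat) (H a rho rho' al l1 l0 ka k1 k0 : R) :
  0 < rho -> 0 < a -> rho < a ^+ 2 ->
  (forall X y, 0 < y -> X ^+ 2 + (y - a) ^+ 2 = rho ->
     let L := al * X + (l1 * y + l0) in
     let K := ka * X + (k1 * y + k0) in
     4 * y ^+ 2 * (m%:R * a * L ^+ 2 - 2 * rho' * y * L
       - 4 * (m.+1)%:R * a * rho * y ^+ 2 + 2 * rho * y * K) ^+ 2
     = (m.+2%:R * H) ^+ 2 * (L ^+ 2 - 4 * rho * y ^+ 2) ^+ 3) ->
  H != 0 \/ (H = 0 /\ (0 < m)%N) ->
  al = 0 /\ l0 = 0.
Proof.
move=> rho0 a0 rhoa E Hn.
(* At [y = 0] the circle has two conjugate complex points, with [X^2 = rho - a^2 < 0]. This sum is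
   the squared modulus of [L] there. *)
suff /eqP: (l0 ^+ 2 + al ^+ 2 * (a ^+ 2 - rho)) = 0.
  have da : 0 < a ^+ 2 - rho by rewrite subr_gt0.
  rewrite paddr_eq0 ?sqr_ge0//; last by rewrite mulr_ge0 ?sqr_ge0 ?(ltW da).
  by rewrite (mulf_eq0 (al ^+ 2)) !sqrf_eq0 (gt_eqF da) orbF => /andP[/eqP-> /eqP->].
(* [A] (resp. [B]) is the product of the values of [L^2 - 4 rho y^2] (resp. of
   the expression squared on the left) at the points [(X, y)] and [(- X, y)] of the
   circle; as [X^2 = s], it is a polynomial in [y] alone, which can be
   evaluated at [y = 0] although the circle lies in the region [y > 0]. *)
pose s : {poly R} := rho%:P - ('X - a%:P) ^+ 2.
pose l : {poly R} := l1%:P * 'X + l0%:P.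
pose k : {poly R} := k1%:P * 'X + k0%:P.
pose q0 : {poly R} := (m%:R * a)%:P * (l ^+ 2 + (al ^+ 2)%:P * s)
  - (2 * rho')%:P * 'X * l - (4 * m.+1%:R * a * rho)%:P * 'X^2
  + (2 * rho)%:P * 'X * k.
pose q1 : {poly R} := (2 * m%:R * a * al)%:P * l - (2 * rho' * al)%:P * 'X
  + (2 * rho * ka)%:P * 'X.
pose A : {poly R} := (l ^+ 2 + (al ^+ 2)%:P * s - (4 * rho)%:P * 'X^2) ^+ 2
  - (4 * al ^+ 2)%:P * l ^+ 2 * s.
pose B : {poly R} := q0 ^+ 2 - s * q1 ^+ 2.
pose hE := (hornerE, horner_exp).
have rs0 : 0 < Num.sqrt rho by rewrite sqrtr_gt0.
have rsE : Num.sqrt rho ^+ 2 = rho by rewrite sqr_sqrtr// ltW.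
have rsa : Num.sqrt rho < a by rewrite -(ltr_pXn2r (n:=2)) ?nnegrE ?rsE ?ltW.
have AB y : a - Num.sqrt rho < y < a + Num.sqrt rho ->
    0 < y /\ exists L1 L2 Q1 Q2, [/\ A.[y] = L1 * L2, B.[y] = Q1 * Q2,
      4 * y ^+ 2 * Q1 ^+ 2 = (m.+2%:R * H) ^+ 2 * L1 ^+ 3 &
      4 * y ^+ 2 * Q2 ^+ 2 = (m.+2%:R * H) ^+ 2 * L2 ^+ 3].
  (* Since [rho < a^2], the whole circle lies in the region [y > 0], where [E] applies. *)
  move=> /andP[y1 y2]; have y0 : 0 < y by lra.
  split=> //.
  have s0 : 0 <= rho - (y - a) ^+ 2 by nra.
  have [X X2] : exists X, X ^+ 2 = rho - (y - a) ^+ 2.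
    by exists (Num.sqrt (rho - (y - a) ^+ 2)); rewrite sqr_sqrtr.
  have rE : rho = X ^+ 2 + (y - a) ^+ 2 by rewrite X2 subrK.
  have := E X y y0; have := E (- X) y y0.
  rewrite sqrrN X2 subrK => /(_ erefl) /= E1 /(_ erefl) /= E2.
  eexists; eexists; eexists; eexists.
  split; [| |exact: E1|exact: E2].
  - rewrite /A /l /s !hE /= rE; ring.
  - rewrite /B /q0 /q1 /k /l /s !hE /= rE; ring.
have A0 : A.[0] = (l0 ^+ 2 + al ^+ 2 * (a ^+ 2 - rho)) ^+ 2.
  by rewrite /A /l /s !hE /=; ring.
have B0 : B.[0] = (m%:R * a) ^+ 2 * (l0 ^+ 2 + al ^+ 2 * (a ^+ 2 - rho)) ^+ 2.
  by rewrite /B /q0 /q1 /k /l /s !hE /=; ring.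
clearbody A B.
have lt_ab : a - Num.sqrt rho < a + Num.sqrt rho by lra.
case: Hn => [HN0 | [H0 m0]].
  (* The product of the equations at [(X, y)] and [(- X, y)] is [16 y^4 B^2 = (d H)^4 A^3]. It holds
     on an interval, hence as an identity of polynomials, and at [y = 0] it leaves [A(0) = 0]
     because [H] is nonzero. *)
  pose C : {poly R} := ((m.+2%:R * H) ^+ 4)%:P * A ^+ 3 - 16%:P * 'X ^+ 4 * B ^+ 2.
  have C0 : C = 0.
    apply: (poly_eq0_on_interval lt_ab) => y /AB[y0 [L1 [L2 [Q1 [Q2 [AE BE E1 E2]]]]]].
    rewrite /C !hE AE BE /=; apply/eqP; rewrite subr_eq0; apply/eqP.
    transitivity (((m.+2%:R * H) ^+ 2 * L1 ^+ 3) * ((m.+2%:R * H) ^+ 2 * L2 ^+ 3));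
      first by ring.
    by rewrite -E1 -E2; ring.
  have : C.[0] = (m.+2%:R * H) ^+ 4 * (l0 ^+ 2 + al ^+ 2 * (a ^+ 2 - rho)) ^+ 6.
    by rewrite /C !hE A0 /=; ring.
  rewrite C0 horner0 => /esym/eqP; rewrite mulf_eq0 !expf_eq0/= mulf_eq0.
  by rewrite pnatr_eq0 (negPf HN0)/= => /eqP.
(* For [H = 0] the equation forces [Q1 = 0] wherever [y > 0]. The value [B(0)] carries the factor
   [(m a)^2], nonzero because [0 < m]. *)
have C0 : B = 0.
  apply: (poly_eq0_on_interval lt_ab) => y /AB[y0 [L1 [L2 [Q1 [Q2 [AE -> E1 E2]]]]]].
  have /eqP : 4 * y ^+ 2 * Q1 ^+ 2 = 0 by rewrite E1 H0; ring.
  by rewrite !mulf_eq0 pnatr_eq0 (gt_eqF y0) /= orbb => /eqP->; rewrite mul0r.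
move: B0; rewrite C0 horner0 => /esym/eqP; rewrite !mulf_eq0 pnatr_eq0 (gt_eqF a0) orbF.
by rewrite eqn0Ngt m0/= orbb => /eqP.
Qed.

(** * Gradients and smooth functions *)

(** A function vanishing near [z] is negligible to first order, so its differential is 0. Applied to
    [g - f], this makes differentiability a local property. *)
Lemma differentiable_near0 (K : numFieldType) (V W : normedModType K) (f : V -> W) z :
  (\forall w \near z, f w = 0) -> differentiable f z.
Proof.
move=> f0; have fz : f z = 0 by exact: nbhs_singleton f0.
have E : f \o shift z = cst (f z) + (0 : V -> W) +o_ 0 id.
  apply/eqaddoP => e e0; rewrite fz.
  have : \forall w \near (0 : V), f (w + z) = 0.
    by move: f0; rewrite (near_shift 0)/= subr0.
  apply: filterS => w fw.
  rewrite /cst /=.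
  rewrite -[(_ - _) w]/(f (w + z) - (0 + 0)) fw addr0 subr0 normr0.
  by rewrite mulr_ge0// ltW.
have E' : 'd f z = (0 : V -> W) :> (V -> W).
  by apply: (diff_unique (df := (\0 : {linear V -> W}))) => // w; exact: cvg_cst.
apply/diff_locallyP; rewrite E'; split => //; exact: cst_continuous.
Qed.

Section Gradients.
Variables (R : realType) (V : normedModType R) (I : Type) (v : I -> V).
Implicit Types (f g : V -> R) (z : V) (d e : I -> R).

(** [smooth_on] asks for Frechet differentiability, so it is carried along with the derivatives in
    the directions [v]. These are the coordinate frame on R^N, or the single vector 1 on the
    line. *)
Definition has_grad f z d :=
  differentiable f z /\ forall i, 'D_(v i) f z = d i.

Lemma has_grad_eq f z d e : (forall i, d i = e i) -> has_grad f z d -> has_grad f z e.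
Proof. by move=> de [df pf]; split=> // i; rewrite pf de. Qed.

Lemma has_grad_near f g z d :
  (\forall w \near z, f w = g w) -> has_grad f z d -> has_grad g z d.
Proof.
move=> fg [df pf]; split; last first.
  by move=> i; rewrite -pf; apply/esym; exact: near_eq_derive.
have -> : g = f + (g - f) by rewrite addrC subrK.
apply: differentiableD => //; apply: differentiable_near0.
by apply: filterS fg => w fgw; rewrite !fctE /= fgw subrr.
Qed.

Lemma has_grad_ext f g z d : f =1 g -> has_grad f z d -> has_grad g z d.
Proof. by move=> /funext->. Qed.

Lemma has_grad_cst (c : R) z : has_grad (fun=> c) z (fun=> 0).
Proof. by split=> [|i]; [exact: differentiable_cst|exact: derive_cst]. Qed.

Lemma has_gradD f g z d e : has_grad f z d -> has_grad g z e ->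
  has_grad (fun w => f w + g w) z (fun i => d i + e i).
Proof.
move=> [df pf] [dg pg]; split=> [|i]; first exact: differentiableD.
by rewrite -pf -pg -deriveD//; exact: diff_derivable.
Qed.

Lemma has_gradM f g z d e : has_grad f z d -> has_grad g z e ->
  has_grad (fun w => f w * g w) z (fun i => f z * e i + g z * d i).
Proof.
move=> [df pf] [dg pg]; split=> [|i]; first exact: differentiableM.
by rewrite -pf -pg -deriveM//; exact: diff_derivable.
Qed.

Lemma has_gradZ (c : R) f z d : has_grad f z d ->
  has_grad (fun w => c * f w) z (fun i => c * d i).
Proof.
move=> df; apply: has_grad_eq (has_gradM (has_grad_cst c z) df) => i /=.
by rewrite mulr0 addr0.
Qed.

Lemma has_gradN f z d : has_grad f z d -> has_grad (fun w => - f w) z (fun i => - d i).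
Proof.
move=> /(has_gradZ (- 1)) df; apply: has_grad_eq (has_grad_ext _ df) => [i|].
  by rewrite mulN1r.
by move=> w; rewrite mulN1r.
Qed.

Lemma has_gradB f g z d e : has_grad f z d -> has_grad g z e ->
  has_grad (fun w => f w - g w) z (fun i => d i - e i).
Proof. by move=> df /has_gradN; exact: has_gradD. Qed.

Lemma has_grad_sum (J : finType) (f : J -> V -> R) z (d : J -> I -> R) :
  (forall j, has_grad (f j) z (d j)) ->
  has_grad (fun w => \sum_j f j w) z (fun i => \sum_j d j i).
Proof.
move=> fd; elim: (index_enum J) => [|j s IH].
  apply: has_grad_eq (has_grad_ext _ (has_grad_cst 0 z)) => [i|].
    by rewrite big_nil.
  by move=> w; rewrite big_nil.
apply: has_grad_eq (has_grad_ext _ (has_gradD (fd j) IH)) => [i|].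
  by rewrite big_cons.
by move=> w; rewrite big_cons.
Qed.

Lemma has_grad_comp (phi : R -> R) f z d (dphi : R) : has_grad f z d ->
  is_derive (f z) 1 phi dphi ->
  has_grad (fun w => phi (f w)) z (fun i => dphi * d i).
Proof.
move=> [df pf] [dphi' <-]; have /derivable1_diffP dphi1 := dphi'.
have dc : differentiable (phi \o f) z by exact: differentiable_comp.
split=> // i; rewrite -pf [LHS]deriveE// diff_comp//= deriv1E//.
by rewrite -derive1E [X in _ = _ * X]deriveE// mulrC.
Qed.

Lemma has_gradV f z d : has_grad f z d -> f z != 0 ->
  has_grad (fun w => (f w)^-1) z (fun i => - (f z) ^- 2 * d i).
Proof.
move=> [df pf] f0; split=> [|i]; first exact: differentiableV.
by rewrite -pf deriveV//; exact: diff_derivable.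
Qed.

Lemma has_gradX f z d k : has_grad f z d ->
  has_grad (fun w => f w ^+ k) z (fun i => k%:R * f z ^+ k.-1 * d i).
Proof.
move=> fd; case: k => [|k].
  apply: has_grad_eq (has_grad_ext _ (has_grad_cst 1 z)) => [i|w].
    by rewrite !mul0r.
  by rewrite expr0.
elim: k => [|k IH].
  by apply: has_grad_eq (has_grad_ext _ fd) => [i|w] /=; [rewrite expr0 !mul1r|rewrite expr1].
apply: has_grad_eq (has_grad_ext _ (has_gradM fd IH)) => [i|w]; last by rewrite -exprS.
by rewrite /= exprS -[k.+2%:R]natr1; ring.
Qed.

(** Level 0 already asks for differentiability. Grading smoothness by [k] lets the closure
    properties be proved by induction; [smooth_on] follows from [Ck k] for all [k]. *)
Fixpoint Ck (k : nat) (U : set V) f : Prop :=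
  (forall z, U z -> differentiable f z) /\
  if k is k'.+1 then forall i, Ck k' U (fun z => 'D_(v i) f z) else True.

Lemma Ck_eq k (U : set V) f g : open U -> (forall z, U z -> f z = g z) ->
  Ck k U f -> Ck k U g.
Proof.
move=> oU; elim: k f g => [|k IH] f g fg /= [df Df].
  split=> // z Uz.
  have nfg : \forall w \near z, f w = g w.
    by apply: filterS (open_nbhs_nbhs (conj oU Uz)) => w /fg.
  by have [] := has_grad_near nfg (conj (df z Uz) (fun i => erefl)).
have nfg z : U z -> \forall w \near z, f w = g w.
  by move=> Uz; apply: filterS (open_nbhs_nbhs (conj oU Uz)) => w /fg.
split=> [z Uz|i].
  by have [] := has_grad_near (nfg z Uz) (conj (df z Uz) (fun i => erefl)).
by apply: (IH _ _ _ (Df i)) => z /nfg; exact: near_eq_derive.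
Qed.

(** This is the induction step of the closure properties below: exhibit the derivatives on [U], then
    show that they have one level less. *)
Lemma Ck_has_grad k (U : set V) f (d : I -> V -> R) : open U ->
  (forall z, U z -> has_grad f z (d ^~ z)) -> (forall i, Ck k U (d i)) -> Ck k.+1 U f.
Proof.
move=> oU fd dk; split=> [z /fd[]//|i].
by apply: Ck_eq oU _ (dk i) => z /fd[_ ->].
Qed.

Lemma Ck_differentiable k (U : set V) f z : Ck k U f -> U z -> differentiable f z.
Proof. by case: k => [|k] [df _]; exact: df. Qed.

Lemma CkW k (U : set V) f : Ck k.+1 U f -> Ck k U f.
Proof.
elim: k f => [|k IH] f [df Df]; first by split.
by split=> // i; exact/IH/Df.
Qed.

Lemma Ck_derive k (U : set V) f i : Ck k.+1 U f -> Ck k U (fun z => 'D_(v i) f z).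
Proof. by move=> [_ Df]; exact: Df. Qed.

Lemma Ck_grad k (U : set V) f z : Ck k U f -> U z ->
  has_grad f z (fun i => 'D_(v i) f z).
Proof. by move=> fk Uz; split=> //; exact: Ck_differentiable fk Uz. Qed.

Lemma Ck_cst k (U : set V) (c : R) : open U -> Ck k U (fun=> c).
Proof.
move=> oU; elim: k c => [|k IH] c; first by split=> // z _; exact: differentiable_cst.
by apply: Ck_has_grad oU _ (fun=> IH 0) => z _; exact: has_grad_cst.
Qed.

Lemma CkD k (U : set V) f g : open U -> Ck k U f -> Ck k U g ->
  Ck k U (fun w => f w + g w).
Proof.
move=> oU; elim: k f g => [|k IH] f g fk gk.
  split=> // z Uz; apply: differentiableD.
    exact: Ck_differentiable fk Uz.
  exact: Ck_differentiable gk Uz.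
apply: (Ck_has_grad (d := fun i z => 'D_(v i) f z + 'D_(v i) g z)) => // [z Uz|i].
  exact: has_gradD (Ck_grad fk Uz) (Ck_grad gk Uz).
by apply: IH; exact: Ck_derive.
Qed.

Lemma CkM k (U : set V) f g : open U -> Ck k U f -> Ck k U g ->
  Ck k U (fun w => f w * g w).
Proof.
move=> oU; elim: k f g => [|k IH] f g fk gk.
  split=> // z Uz; apply: differentiableM.
    exact: Ck_differentiable fk Uz.
  exact: Ck_differentiable gk Uz.
apply: (Ck_has_grad (d := fun i z => f z * 'D_(v i) g z + g z * 'D_(v i) f z)) => //
  [z Uz|i].
  exact: has_gradM (Ck_grad fk Uz) (Ck_grad gk Uz).
by apply: CkD => //; apply: IH; by [exact: CkW|exact: Ck_derive].
Qed.

Lemma CkZ k (U : set V) (c : R) f : open U -> Ck k U f -> Ck k U (fun w => c * f w).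
Proof. by move=> oU; apply: CkM => //; exact: Ck_cst. Qed.

Lemma CkB k (U : set V) f g : open U -> Ck k U f -> Ck k U g ->
  Ck k U (fun w => f w - g w).
Proof.
move=> oU fk /(CkZ (-1) oU) gk; apply: Ck_eq (CkD oU fk gk) => // z _.
by rewrite mulN1r.
Qed.

Lemma CkX k (U : set V) f j : open U -> Ck k U f -> Ck k U (fun w => f w ^+ j).
Proof.
move=> oU fk; elim: j => [|j IH].
  by apply: Ck_eq (Ck_cst _ 1 oU) => // z _; rewrite expr0.
by apply: Ck_eq (CkM oU fk IH) => // z _; rewrite exprS.
Qed.

Lemma Ck_sum k (U : set V) (J : finType) (f : J -> V -> R) : open U ->
  (forall j, Ck k U (f j)) -> Ck k U (fun w => \sum_j f j w).
Proof.
move=> oU fk; elim: (index_enum J) => [|j s IH].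
  by apply: Ck_eq (Ck_cst _ 0 oU) => // z _; rewrite big_nil.
by apply: Ck_eq (CkD oU (fk j) IH) => // z _; rewrite big_cons.
Qed.

Lemma smooth_curve_derive1 (J : set R) (phi : R -> R) :
  smooth_curve_on J phi -> smooth_curve_on J (derive1 phi).
Proof. by move=> sphi k t Jt; rewrite -derive1Sn; exact: sphi. Qed.

(** The chain rule replaces [phi] by its derivative, so the induction runs over all smooth [phi] at
    once. *)
Lemma Ck_comp k (U : set V) (J : set R) (phi : R -> R) f : open U ->
  smooth_curve_on J phi -> (forall z, U z -> J (f z)) ->
  Ck k U f -> Ck k U (fun w => phi (f w)).
Proof.
move=> oU; elim: k phi => [|k IH] phi sphi fJ fk.
  split=> // z Uz; apply: differentiable_comp; first exact: Ck_differentiable fk Uz.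
  by apply/derivable1_diffP; exact: (sphi 0%N _ (fJ z Uz)).
apply: (Ck_has_grad (d := fun i z => derive1 phi (f z) * 'D_(v i) f z)) => // [z Uz|i].
  apply: has_grad_comp (Ck_grad fk Uz) _.
  by rewrite derive1E; apply: derivableP; exact: (sphi 0%N _ (fJ z Uz)).
apply: CkM => //; last exact: Ck_derive.
exact: IH (smooth_curve_derive1 sphi) fJ (CkW fk).
Qed.

End Gradients.

(** On the line the only direction is the vector 1, along which the derivative is [derive1]. The
    closure properties of [Ck] thus carry over to real-valued curves. *)
Lemma smooth_curve_onP (R : realType) (J : set R) (phi : R -> R) :
  smooth_curve_on J phi <-> forall k, Ck (fun _ : unit => 1 : R) k J phi.
Proof.
have De (f : R -> R) : (fun z => 'D_1 f z) = derive1 f.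
  by apply/funext => z; rewrite derive1E.
split=> [sphi k|].
  elim: k phi sphi => [|k IH] phi sphi.
    by split=> // t Jt; apply/derivable1_diffP; exact: (sphi 0%N).
  split=> [t Jt|_]; first by apply/derivable1_diffP; exact: (sphi 0%N).
  by rewrite De; apply/IH/smooth_curve_derive1.
move=> phik k t Jt; elim: k phi phik => [|k IH] phi phik.
  by apply/derivable1_diffP; exact: (Ck_differentiable (phik 0%N)).
rewrite derive1Sn; apply: IH => k'; rewrite -De.
exact: (Ck_derive tt (phik k'.+1)).
Qed.

Lemma smooth_curve_expR (R : realType) : smooth_curve_on setT (@expR R).
Proof.
move=> k t _; have -> : derive1n k (@expR R) = expR; last exact: derivable_expR.
elim: k => [//|k IH]; rewrite derive1nS IH; apply/funext => x.
by rewrite derive1E derive_val.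
Qed.

Lemma smooth_onP (R : realType) N (U : set 'rV[R]_N) (f : 'rV[R]_N -> R) :
  (forall k, Ck (delta_mx 0) k U f) -> smooth_on U f.
Proof.
move=> fk s z Uz; have := fk (size s).
(* [foldr] differentiates first along the last index of [s], so the list is peeled from its end and
   the induction passes from [f] to [partial i f]. *)
elim/last_ind: s f {fk} => [|s i IH] f; first by move=> [df _]; exact: df.
by rewrite size_rcons foldr_rcons => /(Ck_derive i); exact: IH.
Qed.

Lemma has_grad_coord (R : realType) N (z : 'rV[R]_N) j :
  has_grad (delta_mx 0) (fun w => w 0 j) z (fun i => (i == j)%:R).
Proof.
split=> [|i]; first exact: differentiable_coord.
apply: cvg_lim => //; apply: cvg_near_cst.
near=> h; rewrite /= !mxE addrK /= eq_sym.
have h0 : h != 0 by near: h; exact: nbhs_dnbhs_neq.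
by rewrite scalerA mulVf// scale1r.
Unshelve. all: by end_near. Qed.

Lemma Ck_coord (R : realType) N k (U : set 'rV[R]_N) j : open U ->
  Ck (delta_mx 0) k U (fun w => w 0 j).
Proof.
move=> oU; case: k => [|k]; first by split=> // z _; exact: differentiable_coord.
apply: (Ck_has_grad (d := fun i _ => (i == j)%:R)) => // [z _|i].
  exact: has_grad_coord.
exact: Ck_cst.
Qed.

(** * Gradient and divergence in the Lorentzian product *)

Section LorentzFormulas.
Variables (R : realType) (n : nat).
Local Notation point := 'rV[R]_(n.+1 + 1).
Implicit Types (z w : point) (f : point -> R).

Definition xi (j : 'I_n.+1) : 'I_(n.+1 + 1) := lshift 1 j.
Definition ti : 'I_(n.+1 + 1) := rshift n.+1 ord0.
Definition hgt z : R := z 0 (xi ord_max).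

Lemma xi_eq j k : (xi j == xi k) = (j == k).
Proof. by rewrite /xi (inj_eq (@lshift_inj _ _)). Qed.
Lemma xi_ti j : (xi j == ti) = false.
Proof. by rewrite /xi /ti eq_lrshift. Qed.
Lemma ti_xi j : (ti == xi j) = false.
Proof. by rewrite /xi /ti eq_rlshift. Qed.

Lemma space_partE z j : space_part z 0 j = z 0 (xi j).
Proof. by rewrite !mxE. Qed.

Lemma heightE z : height (space_part z) = hgt z.
Proof. by rewrite /height space_partE. Qed.

Lemma row_split (z : point) : z = row_mx (\row_j z 0 (xi j)) (z 0 ti)%:M.
Proof.
rewrite -[LHS]hsubmxK; congr row_mx; apply/rowP => j; rewrite !mxE//.
by rewrite !ord1 eqxx.
Qed.

Lemma sum_split (F : 'I_(n.+1 + 1) -> R) : \sum_i F i = \sum_j F (xi j) + F ti.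
Proof. by rewrite big_split_ord /= big_ord1. Qed.

Lemma innerE z (u v : point) :
  inner (@lorentz R n) z u v =
  hgt z ^- 2 * (\sum_j u 0 (xi j) * v 0 (xi j)) - u 0 ti * v 0 ti.
Proof.
rewrite /inner /lorentz heightE {1}(row_split u) mul_row_block !mulmx0 addr0 add0r.
rewrite {1}(row_split v) tr_row_mx mul_row_col tr_scalar_mx mulmxN mulmx1 !mxE.
congr (_ + _); last first.
  by rewrite big_ord1 !mxE !eqxx mulNr.
rewrite mulr_sumr; apply: eq_bigr => j _; rewrite mul_mx_scalar !mxE mulrA; ring.
Qed.

Lemma invmx_lorentz z : 0 < hgt z ->
  invmx (@lorentz R n z) = block_mx (hgt z ^+ 2)%:M 0 0 (- 1%:M).
Proof.
move=> z0; have E : lorentz z *m block_mx (hgt z ^+ 2)%:M 0 0 (- 1%:M) = 1%:M.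
  rewrite /lorentz heightE mulmx_block !mulmx0 !mul0mx !addr0 !add0r.
  rewrite mulmxN mulNmx opprK mulmx1 -scalar_mxM mulVf ?expf_neq0 ?gt_eqF//.
  by rewrite -scalar_mx_block.
have [lu _] := mulmx1_unit E.
by rewrite -[RHS]mul1mx -(mulVmx lu) -mulmxA E mulmx1.
Qed.

Lemma grad_split f z : 0 < hgt z ->
  grad (@lorentz R n) f z =
  row_mx (\row_j (hgt z ^+ 2 * partial (xi j) f z)) (- partial ti f z)%:M.
Proof.
move=> z0; rewrite /grad invmx_lorentz// [\row_j partial j f z]row_split.
rewrite mul_row_block !mulmx0 addr0 add0r mulmxN mulmx1 mul_mx_scalar.
congr row_mx; apply/rowP => j; rewrite !mxE//.
by rewrite mulNrn.
Qed.

Lemma grad_xi f z j : 0 < hgt z ->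
  grad (@lorentz R n) f z 0 (xi j) = hgt z ^+ 2 * partial (xi j) f z.
Proof. by move=> z0; rewrite grad_split// /xi row_mxEl mxE. Qed.

Lemma grad_ti f z : 0 < hgt z -> grad (@lorentz R n) f z 0 ti = - partial ti f z.
Proof. by move=> z0; rewrite grad_split// /ti row_mxEr mxE eqxx mulr1n. Qed.

Lemma vol_densityE z : 0 < hgt z -> vol_density (@lorentz R n) z = (hgt z ^+ n.+1)^-1.
Proof.
move=> z0; rewrite /vol_density /lorentz heightE det_ublock det_scalar -scaleN1r detZ det1.
rewrite expr1 mulr1 mulrN1 normrN -exprVn -exprM mulnC exprM.
by rewrite ger0_norm ?sqr_ge0// sqrtr_sqr ger0_norm ?exprVn// invr_ge0 exprn_ge0 ?ltW.
Qed.

(* The value of [- <grad f, grad f>] at height [y] when [D] is the family of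
   partial derivatives of [f]. *)
Definition grad_norm2 (D : 'I_(n.+1 + 1) -> R) (y : R) : R :=
  D ti ^+ 2 - y ^+ 2 * \sum_j D (xi j) ^+ 2.

Lemma inner_gradE f z : 0 < hgt z ->
  - inner (@lorentz R n) z (grad (@lorentz R n) f z) (grad (@lorentz R n) f z)
  = grad_norm2 (fun i => partial i f z) (hgt z).
Proof.
move=> z0; rewrite innerE grad_ti// /grad_norm2 opprB; congr (_ - _); first by ring.
under eq_bigr do rewrite grad_xi//.
rewrite !mulr_sumr; apply: eq_bigr => j _; field; exact: lt0r_neq0.
Qed.

End LorentzFormulas.

(** * Divergence of the unit gradient field *)

Section LorentzDivergence.
Variables (R : realType) (n : nat).
Local Notation point := 'rV[R]_(n.+1 + 1).
Local Notation has_grad := (@has_grad R point _ (delta_mx 0)).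
Implicit Types (z w : point) (f : point -> R).

Lemma has_grad_hgt z : has_grad (@hgt R n) z (fun i => (i == xi ord_max)%:R).
Proof. exact: has_grad_coord. Qed.

Lemma near_hgt_gt0 z : 0 < hgt z -> \forall w \near z, 0 < hgt w.
Proof.
move=> z0; have [/differentiable_continuous hc _] := has_grad_hgt z.
exact: (cvgr_gt (hgt z) hc).
Qed.

Lemma has_grad_invsqrt f z d : has_grad f z d -> 0 < f z ->
  has_grad (fun w => (Num.sqrt (f w))^-1) z
    (fun i => - (Num.sqrt (f z))^-1 ^+ 3 / 2 * d i).
Proof.
move=> fd f0; have sf0 : Num.sqrt (f z) != 0 by rewrite gt_eqF// sqrtr_gt0.
apply: has_grad_eq (has_gradV (has_grad_comp fd (is_derive1_sqrt f0)) sf0) => i.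
by field.
Qed.

Lemma has_grad_grad_norm2 (D : 'I_(n.+1 + 1) -> point -> R)
    (DD : 'I_(n.+1 + 1) -> 'I_(n.+1 + 1) -> R) z :
  (forall i, has_grad (D i) z (DD i)) ->
  has_grad (fun w => grad_norm2 (D ^~ w) (hgt w)) z
   (fun i => 2 * D (ti n) z * DD (ti n) i
     - 2 * hgt z * (i == xi ord_max)%:R * (\sum_j D (xi j) z ^+ 2)
     - 2 * hgt z ^+ 2 * \sum_j D (xi j) z * DD (xi j) i).
Proof.
move=> DDd; have := has_gradB (has_gradX 2 (DDd (ti n)))
  (has_gradM (has_gradX 2 (has_grad_hgt z)) (has_grad_sum (fun j => has_gradX 2 (DDd (xi j))))).
apply: has_grad_eq => i /=; rewrite !expr1.
have -> : \sum_j 2 * D (xi j) z * DD (xi j) i = 2 * \sum_j D (xi j) z * DD (xi j) i.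
  by rewrite mulr_sumr; apply: eq_bigr => j _; rewrite mulrA.
ring.
Qed.

Lemma has_grad_vol z : 0 < hgt z ->
  has_grad (vol_density (@lorentz R n)) z
    (fun i => - n.+1%:R / hgt z / hgt z ^+ n.+1 * (i == xi ord_max)%:R).
Proof.
move=> z0; have z1 : hgt z ^+ n.+1 != 0 by rewrite expf_neq0// gt_eqF.
apply: has_grad_near; last first.
  apply: has_grad_eq (has_gradV (has_gradX n.+1 (has_grad_hgt z)) z1) => i /=.
  by move: z1; rewrite exprS mulf_eq0 negb_or => /andP[z1 z2]; field; rewrite z1 z2.
by apply: filterS (near_hgt_gt0 z0) => w w0; rewrite vol_densityE.
Qed.

(** With [V = W2^(-1/2)], the field has components [V y^2 D_j] in space and [- V D_t] in time, and
    the volume density is [y^-(n+1)]. The terms in [V^3] come from differentiating [V], those in [V]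
    from the other factors; the coefficient [1 - n] is [2 - (n + 1)], from [y^2] and the density. *)
Lemma divergence_unit_gradE f (D : 'I_(n.+1 + 1) -> point -> R)
  (DD : 'I_(n.+1 + 1) -> 'I_(n.+1 + 1) -> R) z (y := hgt z)
  (W2 := grad_norm2 (D ^~ z) y) :
  0 < y -> 0 < W2 ->
  (\forall w \near z, forall i, partial i f w = D i w) ->
  (forall i, has_grad (D i) z (DD i)) ->
  divergence (@lorentz R n) (unit_grad f) z =
  (Num.sqrt W2)^-1 * (y ^+ 2 * (\sum_j DD (xi j) (xi j))
    + (1 - n%:R) * y * D (xi ord_max) z - DD (ti n) (ti n))
  - (Num.sqrt W2)^-1 ^+ 3 *
  (y ^+ 2 * (\sum_j D (xi j) z * (D (ti n) z * DD (ti n) (xi j)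
      - y ^+ 2 * \sum_k D (xi k) z * DD (xi k) (xi j)))
    - y ^+ 3 * D (xi ord_max) z * \sum_j D (xi j) z ^+ 2
    - D (ti n) z * (D (ti n) z * DD (ti n) (ti n)
      - y ^+ 2 * \sum_k D (xi k) z * DD (xi k) (ti n))).
Proof.
move=> y0 W0 fD DDd.
have yN0 : y != 0 by rewrite gt_eqF.
have gW := has_grad_grad_norm2 DDd.
have gV := has_grad_invsqrt gW W0.
rewrite -/y -/W2 in gV.
set V := (Num.sqrt W2)^-1 in gV *.
pose v := (y ^+ n.+1)^-1.
have vN0 : v != 0 by rewrite invr_neq0// expf_neq0.
have gv := has_grad_vol y0; rewrite -/y -/v in gv.
pose Vw w := (Num.sqrt (grad_norm2 (D ^~ w) (hgt w)))^-1.
pose Y i w := vol_density (@lorentz R n) w * unit_grad f w 0 i.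
(* The components are about to be differentiated, so their closed form is needed on a neighborhood
   of [z]. *)
have YE : \forall w \near z,
    Y (ti n) w = vol_density (@lorentz R n) w * - (Vw w * D (ti n) w) /\
    forall j, Y (xi j) w =
      vol_density (@lorentz R n) w * (Vw w * (hgt w ^+ 2 * D (xi j) w)).
  near=> w; have w0 : 0 < hgt w by near: w; exact: near_hgt_gt0.
  have fDw i : partial i f w = D i w by move: i; near: w.
  rewrite /Y /unit_grad inner_gradE//.
  have -> : (fun i => partial i f w) = (D ^~ w) by exact/funext.
  by split=> [|j]; rewrite mxE ?grad_ti ?grad_xi// fDw ?mulrN.
have Pt : partial (ti n) (Y (ti n)) z =
  - v * V * DD (ti n) (ti n) + v * D (ti n) z * V ^+ 3 / 2 *
   (2 * D (ti n) z * DD (ti n) (ti n)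
    - 2 * y ^+ 2 * \sum_k D (xi k) z * DD (xi k) (ti n)).
  suff [_ E] : has_grad (Y (ti n)) z
    (fun i => v * - (V * DD (ti n) i + D (ti n) z *
     (- V ^+ 3 / 2 * (2 * D (ti n) z * DD (ti n) i
     - 2 * y * (i == xi ord_max)%:R * (\sum_j D (xi j) z ^+ 2)
     - 2 * y ^+ 2 * \sum_j D (xi j) z * DD (xi j) i))) + - (V * D (ti n) z) *
     (- n.+1%:R / y * v * (i == xi ord_max)%:R)).
    by rewrite [LHS]E ti_xi !mulr0n !mulr0; field.
  have := has_gradM gv (has_gradN (has_gradM gV (DDd (ti n)))).
  rewrite vol_densityE// -/y -/v -/W2 -/V; apply: has_grad_near.
  by apply: filterS YE => w [-> _].
have Px j : partial (xi j) (Y (xi j)) z =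
  v * V * y ^+ 2 * DD (xi j) (xi j)
   + (1 - n%:R) * v * V * y * ((xi j == xi ord_max)%:R * D (xi j) z)
   - v * y ^+ 2 * V ^+ 3 * (D (xi j) z * (D (ti n) z * DD (ti n) (xi j)
      - y ^+ 2 * \sum_k D (xi k) z * DD (xi k) (xi j)))
   + v * y ^+ 3 * V ^+ 3 * (\sum_k D (xi k) z ^+ 2)
     * ((xi j == xi ord_max)%:R * D (xi j) z).
  have [_ E] : has_grad (Y (xi j)) z
    (fun i => v * (V * (y ^+ 2 * DD (xi j) i + D (xi j) z * (2 * y * (i == xi ord_max)%:R))
      + y ^+ 2 * D (xi j) z * (- V ^+ 3 / 2 * (2 * D (ti n) z * DD (ti n) i
     - 2 * y * (i == xi ord_max)%:R * (\sum_j D (xi j) z ^+ 2)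
     - 2 * y ^+ 2 * \sum_j D (xi j) z * DD (xi j) i))) + (V * (y ^+ 2 * D (xi j) z)) *
     (- n.+1%:R / y * v * (i == xi ord_max)%:R)).
    have := has_gradM gv (has_gradM gV
      (has_gradM (has_gradX 2 (has_grad_hgt z)) (DDd (xi j)))).
    rewrite vol_densityE// -/y -/v -/W2 -/V expr1; apply: has_grad_near.
    by apply: filterS YE => w [_ ->].
  by rewrite [LHS]E -[n.+1%:R]natr1; field.
rewrite /divergence sum_split [partial (ti n) _ _]Pt.
rewrite (eq_bigr _ (fun j _ => Px j)) vol_densityE// -/y -/v.
rewrite !big_split/= sumrN -!mulr_sumr.
have -> : \sum_j (xi j == xi ord_max)%:R * D (xi j) z = D (xi ord_max) z.
  rewrite (bigD1 ord_max)//= eqxx mul1r big1 ?addr0// => j /negPf jm.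
  by rewrite xi_eq jm mul0r.
by field.
Unshelve. all: by end_near. Qed.

End LorentzDivergence.

(** * Spheres moving in time *)

Lemma smooth_curve_is_derive (R : realType) (J : set R) (phi : R -> R) t :
  smooth_curve_on J phi -> J t -> is_derive t 1 phi (derive1 phi t).
Proof. by move=> sphi Jt; rewrite derive1E; apply: derivableP; exact: (sphi 0%N). Qed.

Section MovingSphere.
Variables (R : realType) (m : nat).
Local Notation point := 'rV[R]_(m.+2 + 1).
Local Notation has_grad := (@has_grad R point _ (delta_mx 0)).
Local Notation tm := (ti m.+1).
Variables (J : set R) (c : 'I_m.+2 -> R -> R) (rho : R -> R) (e : R).
Hypotheses (cJ : forall j, smooth_curve_on J (c j)) (rhoJ : smooth_curve_on J rho).
Hypothesis e2 : e ^+ 2 = 1.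
Implicit Types z w : point.

Definition offset (j : 'I_m.+2) w : R := w 0 (xi j) - c j (w 0 tm).
(** The sign [e] selects one of the two unit normals of the same zero set. *)
Definition sphere_fun w : R := e * (\sum_j offset j w ^+ 2 - rho (w 0 tm)).
(** [sphere_fun_t] and [sphere_fun_tt] are the [L] and [K] of the opening comment, taken for
    [e = 1]. The squared velocities in [K] arise because [offset] itself depends on time. *)
Definition sphere_fun_t w : R :=
  - 2 * (\sum_j offset j w * derive1 (c j) (w 0 tm)) - derive1 rho (w 0 tm).
Definition sphere_fun_tt w : R :=
  - 2 * (\sum_j (offset j w * derive1 (derive1 (c j)) (w 0 tm)
                 - derive1 (c j) (w 0 tm) ^+ 2))
  - derive1 (derive1 rho) (w 0 tm).

Definition sphere_D (i : 'I_(m.+2 + 1)) w : R :=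
  match fintype.split i with
  | inl j => e * (2 * offset j w)
  | inr _ => e * sphere_fun_t w
  end.

Definition sphere_DD z (i k : 'I_(m.+2 + 1)) : R :=
  match fintype.split i with
  | inl j => e * (2 * ((k == xi j)%:R - derive1 (c j) (z 0 tm) * (k == tm)%:R))
  | inr _ => e * (- 2 * (\sum_j derive1 (c j) (z 0 tm) * (k == xi j)%:R)
                  + sphere_fun_tt z * (k == tm)%:R)
  end.

Lemma split_xi j : fintype.split (xi j : 'I_(m.+2 + 1)) = inl j.
Proof. exact: (unsplitK (inl j)). Qed.
Lemma split_ti : fintype.split (tm : 'I_(m.+2 + 1)) = inr ord0.
Proof. exact: (unsplitK (inr ord0)). Qed.

Lemma xi_ti_ind (P : 'I_(m.+2 + 1) -> Prop) :
  (forall j, P (xi j)) -> P tm -> forall i, P i.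
Proof.
move=> Px Pt i; rewrite -(splitK i); case: (fintype.split i) => j; first exact: Px.
by rewrite (ord1 j).
Qed.

Lemma has_grad_time (phi : R -> R) z : smooth_curve_on J phi -> J (z 0 tm) ->
  has_grad (fun w => phi (w 0 tm)) z (fun i => derive1 phi (z 0 tm) * (i == tm)%:R).
Proof.
move=> sphi Jz; apply: has_grad_comp; first exact: has_grad_coord.
exact: smooth_curve_is_derive sphi Jz.
Qed.

Lemma has_grad_offset j z : J (z 0 tm) ->
  has_grad (offset j) z
    (fun i => (i == xi j)%:R - derive1 (c j) (z 0 tm) * (i == tm)%:R).
Proof.
move=> Jz; apply: has_gradB; first exact: has_grad_coord.
exact: has_grad_time (@cJ j) Jz.
Qed.

Lemma sum_delta (F : 'I_m.+2 -> R) k : \sum_j F j * (xi k == xi j)%:R = F k.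
Proof.
rewrite (bigD1 k)//= eqxx mulr1 big1 ?addr0// => j /negPf jk.
by rewrite xi_eq eq_sym jk mulr0.
Qed.

Lemma has_grad_sphere_fun z : J (z 0 tm) -> has_grad sphere_fun z (sphere_D ^~ z).
Proof.
move=> Jz; have := has_gradZ e (has_gradB
  (has_grad_sum (fun j => has_gradX 2 (has_grad_offset j Jz))) (has_grad_time rhoJ Jz)).
apply: has_grad_eq; apply: xi_ti_ind => [k|]; rewrite /sphere_D.
  rewrite split_xi xi_ti; congr (_ * _).
  rewrite mulr0 subr0 -[RHS](sum_delta (fun k => 2 * offset k z)).
  by apply: eq_bigr => j _; rewrite mulr0 subr0 expr1.
rewrite split_ti eqxx mulr1; congr (_ * (_ - _)).
by rewrite mulr_sumr; apply: eq_bigr => j _; rewrite ti_xi expr1 sub0r mulr1; ring.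
Qed.

Lemma has_grad_sphere_D z i : J (z 0 tm) -> has_grad (sphere_D i) z (sphere_DD z i).
Proof.
move=> Jz; move: i; apply: xi_ti_ind => [j|].
  rewrite /sphere_D /sphere_DD split_xi.
  exact: has_gradZ (has_gradZ 2 (has_grad_offset j Jz)).
rewrite /sphere_D /sphere_DD split_ti.
apply: has_gradZ.
have := has_gradB (has_gradZ (-2) (has_grad_sum (fun j =>
  has_gradM (has_grad_offset j Jz) (has_grad_time (smooth_curve_derive1 (@cJ j)) Jz))))
  (has_grad_time (smooth_curve_derive1 rhoJ) Jz).
apply: has_grad_eq => k.
rewrite /sphere_fun_tt mulrBl addrA; congr (_ - _).
rewrite -mulrA -mulrDr; congr (_ * _).
rewrite mulr_suml -big_split/=; apply: eq_bigr => j _; ring.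
Qed.

Lemma Ck_sphere_fun k (U : set point) : open U -> (forall z, U z -> J (z 0 tm)) ->
  Ck (delta_mx 0) k U sphere_fun.
Proof.
move=> oU UJ; have Ck_time (phi : R -> R) : smooth_curve_on J phi ->
    Ck (delta_mx 0) k U (fun w : point => phi (w 0 tm)).
  by move=> sphi; apply: Ck_comp sphi UJ _ => //; exact: Ck_coord.
apply: CkZ => //; apply: CkB => //; last exact: Ck_time rhoJ.
apply: Ck_sum => // j; apply: CkX => //; apply: CkB => //; first exact: Ck_coord.
exact: Ck_time (@cJ j).
Qed.

Lemma sphere_grad_norm2 z : \sum_j offset j z ^+ 2 = rho (z 0 tm) ->
  grad_norm2 (sphere_D ^~ z) (hgt z) =
  sphere_fun_t z ^+ 2 - 4 * rho (z 0 tm) * hgt z ^+ 2.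
Proof.
move=> zrho; rewrite /grad_norm2 /sphere_D split_ti.
under eq_bigr do rewrite split_xi !exprMn e2 mul1r.
rewrite -mulr_sumr zrho exprMn e2; ring.
Qed.

(** The divergence has the form [V A - V^3 B] with [V^2 W2 = 1], so squaring it and multiplying by
    [W2^3] leaves [(W2 A - B)^2], free of square roots. Here [W2 A - B = 2 e y Q], and the square
    also removes the sign. *)
Lemma divergence_sphere z (t := z 0 tm) (y := hgt z) (a := c ord_max t)
    (L := sphere_fun_t z) (K := sphere_fun_tt z) (W2 := L ^+ 2 - 4 * rho t * y ^+ 2) :
  (\forall s \near t, J s) -> 0 < y -> \sum_j offset j z ^+ 2 = rho t -> 0 < W2 ->
  W2 ^+ 3 * divergence (@lorentz R m.+1) (unit_grad sphere_fun) z ^+ 2 =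
  4 * y ^+ 2 * (m%:R * a * L ^+ 2 - 2 * derive1 rho t * y * L
       - 4 * m.+1%:R * a * rho t * y ^+ 2 + 2 * rho t * y * K) ^+ 2.
Proof.
move=> nJ y0 zrho W0.
have Jt : J t by exact: nbhs_singleton nJ.
have nJz : \forall w \near z, J ((w : point) 0 tm).
  have /differentiable_continuous tc := differentiable_coord z 0 tm.
  exact: (tc _ nJ).
rewrite (divergence_unit_gradE (D := sphere_D) (DD := sphere_DD z)) //; first last.
- by move=> i; exact: has_grad_sphere_D.
- by apply: filterS nJz => w Jw i; have [_ E] := has_grad_sphere_fun Jw; exact: E.
- by rewrite sphere_grad_norm2.
rewrite sphere_grad_norm2// -/y -/t -/L -/W2.
set V := (Num.sqrt W2)^-1.
have VW : V ^+ 2 * W2 = 1 by rewrite exprVn sqr_sqrtr ?ltW// mulVf// gt_eqF.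
(* Apart from [L] and [K], the velocity of the center enters only through this sum, which is in turn
   expressed by [L] and the derivative of [rho]. *)
set sX := \sum_j offset j z * derive1 (c j) t.
have LE : sX = - (L + derive1 rho t) / 2.
  by rewrite /L /sphere_fun_t -/sX -/t; field.
have s1 : \sum_j sphere_DD z (xi j) (xi j) = e * 2 * m.+2%:R.
  rewrite (eq_bigr (fun=> e * 2)) => [|j _].
    by rewrite sumr_const card_ord [RHS]mulr_natr.
  by rewrite /sphere_DD split_xi eqxx xi_ti mulr0 subr0 mulr1.
have s2 : \sum_j sphere_D (xi j) z ^+ 2 = 4 * rho t.
  rewrite -zrho mulr_sumr; apply: eq_bigr => j _.
  by rewrite /sphere_D split_xi !exprMn e2; ring.
have s3 j : \sum_k sphere_D (xi k) z * sphere_DD z (xi k) (xi j) = 4 * offset j z.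
  rewrite -[RHS](sum_delta (fun j => 4 * offset j z)); apply: eq_bigr => k _.
  rewrite /sphere_D /sphere_DD split_xi xi_ti mulr0 subr0.
  transitivity (e ^+ 2 * (4 * offset k z * (xi j == xi k)%:R)); first by ring.
  by rewrite e2 mul1r.
have s4 : \sum_k sphere_D (xi k) z * sphere_DD z (xi k) tm = - 4 * sX.
  rewrite mulr_sumr; apply: eq_bigr => k _.
  rewrite /sphere_D /sphere_DD split_xi ti_xi eqxx -/t sub0r mulr1.
  transitivity (e ^+ 2 * (- 4 * (offset k z * derive1 (c k) t))); first by ring.
  by rewrite e2 mul1r.
have Dt : sphere_D tm z = e * L by rewrite /sphere_D split_ti.
have DDt j : sphere_DD z tm (xi j) = - 2 * e * derive1 (c j) t.
  rewrite /sphere_DD split_ti xi_ti mulr0 addr0 sum_delta -/t; ring.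
have DDtt : sphere_DD z tm tm = e * K.
  rewrite /sphere_DD split_ti eqxx mulr1 big1 ?mulr0 ?add0r// => j _.
  by rewrite ti_xi mulr0.
have Dn : sphere_D (xi ord_max) z = e * (2 * (y - a)) by rewrite /sphere_D split_xi.
have s5 : \sum_j sphere_D (xi j) z * (sphere_D tm z * sphere_DD z tm (xi j)
    - y ^+ 2 * \sum_k sphere_D (xi k) z * sphere_DD z (xi k) (xi j)) =
    - 4 * e * L * sX - 8 * e * y ^+ 2 * rho t.
  transitivity (\sum_j (- 4 * e * L * (offset j z * derive1 (c j) t)
      - 8 * e * y ^+ 2 * offset j z ^+ 2)); last first.
    by rewrite sumrB -!mulr_sumr zrho.
  apply: eq_bigr => j _; rewrite s3 Dt DDt /sphere_D split_xi.
  transitivity (e ^+ 2 * (- 4 * e * L * (offset j z * derive1 (c j) t))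
      - 8 * e * y ^+ 2 * offset j z ^+ 2); first by ring.
  by rewrite e2 mul1r.
rewrite s5 s1 s2 s4 Dt DDtt Dn LE.
(* The cubic occurrence of [e] is reduced by hand, since [field] does not know that [e^2 = 1]. *)
have e3 Z : e * L * (e * L * (e * K) - Z) = e * (L * (L * K - Z)).
  transitivity (e * (L * (L * (e ^+ 2 * K) - Z))); first by ring.
  by rewrite e2 mul1r.
rewrite e3.
set A := (X in V * X - _); set B := (X in _ - V ^+ 3 * X).
have -> : W2 ^+ 3 * (V * A - V ^+ 3 * B) ^+ 2 = (W2 * A - B) ^+ 2.
  transitivity ((V ^+ 2 * W2) * (W2 * A - (V ^+ 2 * W2) * B) ^+ 2); first by ring.
  by rewrite VW !mul1r.
have -> : W2 * A - B = e * (2 * y * (m%:R * a * L ^+ 2 - 2 * derive1 rho t * y * L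
       - 4 * m.+1%:R * a * rho t * y ^+ 2 + 2 * rho t * y * K)).
  by rewrite /A /B /W2 -[m.+2%:R]natr1 -[m.+1%:R]natr1; field.
rewrite exprMn e2; ring.
Qed.

End MovingSphere.

(** * Geodesic spheres as Euclidean spheres *)

Section GeodesicSphere.
Variable R : realType.

Definition cosh (x : R) : R := (expR x + expR (- x)) / 2.
Definition sinh (x : R) : R := (expR x - expR (- x)) / 2.

Lemma cosh2_sub_sinh2 x : cosh x ^+ 2 - sinh x ^+ 2 = 1.
Proof.
have := expRxMexpNx_1 x; rewrite /cosh /sinh => E.
by transitivity (expR x * expR (- x)); [field|].
Qed.

Lemma sinh_gt0 x : 0 < x -> 0 < sinh x.
Proof. by move=> x0; rewrite divr_gt0// subr_gt0 ltr_expR; lra. Qed.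

Lemma cosh_gt0 x : 0 < cosh x.
Proof. by rewrite divr_gt0// addr_gt0// expR_gt0. Qed.

Lemma cosh_add_sinh x : cosh x + sinh x = expR x.
Proof. by rewrite /cosh /sinh; field. Qed.

(** The numbers [s + sqrt(s^2 - 1)] and [s - sqrt(s^2 - 1)] have product 1. If the first is
    [expR r], the second is [expR (- r)], and their half sum [s] is [cosh r]. *)
Lemma arcosh_eq (s r : R) : 1 <= s -> 0 < r -> arcosh s = r <-> s = cosh r.
Proof.
move=> s1 r0; have s2 : 0 <= s ^+ 2 - 1 by rewrite subr_ge0 expr_ge1//; lra.
have S0 := sinh_gt0 r0; have CS := cosh2_sub_sinh2 r.
split=> [sr|->].
  have u0 : 0 < s + Num.sqrt (s ^+ 2 - 1) by rewrite ltr_wpDr ?sqrtr_ge0//; lra.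
  have E : s + Num.sqrt (s ^+ 2 - 1) = expR r by rewrite -sr lnK.
  have E' : s - Num.sqrt (s ^+ 2 - 1) = expR (- r).
    rewrite expRN -E; apply: (mulIf (lt0r_neq0 u0)); rewrite mulVf ?lt0r_neq0//.
    by rewrite -subr_sqr sqr_sqrtr//; ring.
  by rewrite /cosh -E -E'; field.
rewrite /arcosh (_ : _ - 1 = sinh r ^+ 2); last by lra.
by rewrite sqrtr_sqr gtr0_norm// cosh_add_sinh expRK.
Qed.

Definition euclidean_center n (p : 'rV[R]_n.+1) (r : R) (j : 'I_n.+1) : R :=
  if j == ord_max then height p * cosh r else p 0 j.

(** By [arcosh_eq], distance [r] means [|p - x|^2 = 2 h y (cosh r - 1)], with [h] and [y] the
    heights of [p] and [x]. Completing the square in [y] moves the center up to [h cosh r] and adds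
    [(h sinh r)^2]. *)
Lemma geodesic_sphereE n (p x : 'rV[R]_n.+1) (r : R) : half_space p -> 0 < r ->
  geodesic_sphere p r x <-> half_space x /\
  \sum_j (x 0 j - euclidean_center p r j) ^+ 2 = (height p * sinh r) ^+ 2.
Proof.
move=> p0 r0; rewrite /geodesic_sphere /=.
suff E : half_space x -> hdist p x = r <-> 
    \sum_j (x 0 j - euclidean_center p r j) ^+ 2 = (height p * sinh r) ^+ 2.
  by split=> -[x0 /(E x0)].
move=> x0; rewrite /half_space /= in p0 x0.
have d0 : 0 < 2 * height p * height x by rewrite !mulr_gt0.
have s0 : 0 <= sqnorm (p - x) by apply: sumr_ge0 => j _; exact: sqr_ge0.
have -> : \sum_j (x 0 j - euclidean_center p r j) ^+ 2 =
   sqnorm (p - x) - 2 * height p * height x * (cosh r - 1) + (height p * sinh r) ^+ 2.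
  rewrite /sqnorm (bigD1 ord_max)//= [in RHS](bigD1 ord_max)//= /euclidean_center eqxx.
  rewrite (eq_bigr (fun j => (p - x) 0 j ^+ 2)) => [|j /negPf->]; last first.
    by rewrite !mxE; ring.
  rewrite !mxE -/(height x) -/(height p).
  have -> : (height p * sinh r) ^+ 2 = height p ^+ 2 * (cosh r ^+ 2 - 1).
    by rewrite exprMn -(cosh2_sub_sinh2 r); ring.
  ring.
rewrite /hdist arcosh_eq//; last by rewrite lerDl divr_ge0// ltW.
split=> [<-|E].
  by field; rewrite !gt_eqF.
have {}E : sqnorm (p - x) = 2 * height p * height x * (cosh r - 1).
  by apply/eqP; rewrite -subr_eq0 -(inj_eq (addIr ((height p * sinh r) ^+ 2))) E add0r.
by rewrite E; field; rewrite !gt_eqF.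
Qed.

End GeodesicSphere.

(** * Smoothness of the Euclidean centers and squared radii *)

Section SmoothCurves.
Variables (R : realType) (J : set R).
Hypothesis oJ : open J.

Lemma smooth_curve_coord n (p : R -> 'rV[R]_n) j :
  smooth_curve_on J p -> smooth_curve_on J (fun t => p t 0 j).
Proof.
move=> sp; apply/smooth_curve_onP => k; elim: k p sp => [|k IH] p sp.
  split=> // t Jt; apply/derivable1_diffP.
  by have /derivable_mxP := sp 0%N t Jt; exact.
split=> [t Jt|_].
  apply/derivable1_diffP.
  by have /derivable_mxP := sp 0%N t Jt; exact.
apply: (Ck_eq oJ _ (IH (derive1 p) _)) => [t Jt|k' t Jt].
  by rewrite derive1E derive_mx ?mxE//; exact: (sp 0%N).
by rewrite -derive1Sn; exact: sp.
Qed.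

Lemma smooth_curveM (f g : R -> R) : smooth_curve_on J f -> smooth_curve_on J g ->
  smooth_curve_on J (fun t => f t * g t).
Proof.
move=> sf sg; apply/smooth_curve_onP => k.
exact: CkM oJ ((smooth_curve_onP _ _).1 sf k) ((smooth_curve_onP _ _).1 sg k).
Qed.

Lemma Ck_expR k (f : R -> R) (v : unit -> R := fun=> 1) :
  Ck v k J f -> Ck v k J (fun t => expR (f t)).
Proof. by apply: Ck_comp oJ (@smooth_curve_expR R) _. Qed.

Lemma CkN k (f : R -> R) (v : unit -> R := fun=> 1) :
  Ck v k J f -> Ck v k J (fun t => - f t).
Proof. by move=> /(CkZ (-1) oJ); apply: Ck_eq oJ _ => t _; rewrite mulN1r. Qed.

Lemma smooth_curve_cosh (r : R -> R) :
  smooth_curve_on J r -> smooth_curve_on J (fun t => cosh (r t)).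
Proof.
move=> sr; apply/smooth_curve_onP => k; have rk := (smooth_curve_onP _ _).1 sr k.
apply: CkM oJ _ (Ck_cst _ _ _ oJ).
exact: CkD oJ (Ck_expR rk) (Ck_expR (CkN rk)).
Qed.

Lemma smooth_curve_sinh (r : R -> R) :
  smooth_curve_on J r -> smooth_curve_on J (fun t => sinh (r t)).
Proof.
move=> sr; apply/smooth_curve_onP => k; have rk := (smooth_curve_onP _ _).1 sr k.
apply: CkM oJ _ (Ck_cst _ _ _ oJ).
exact: CkB oJ (Ck_expR rk) (Ck_expR (CkN rk)).
Qed.

Lemma smooth_curve_center n (p : R -> 'rV[R]_n.+1) (r : R -> R) j :
  smooth_curve_on J p -> smooth_curve_on J r ->
  smooth_curve_on J (fun t => euclidean_center (p t) (r t) j).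
Proof.
move=> sp sr; rewrite /euclidean_center; case: (j == ord_max); last exact: smooth_curve_coord.
apply: smooth_curveM; last exact: smooth_curve_cosh.
exact: smooth_curve_coord.
Qed.

Lemma smooth_curve_radius2 n (p : R -> 'rV[R]_n.+1) (r : R -> R) :
  smooth_curve_on J p -> smooth_curve_on J r ->
  smooth_curve_on J (fun t => (height (p t) * sinh (r t)) ^+ 2).
Proof.
move=> sp sr.
have s : smooth_curve_on J (fun t => height (p t) * sinh (r t)).
  apply: smooth_curveM; last exact: smooth_curve_sinh.
  exact: smooth_curve_coord.
exact: smooth_curveM.
Qed.

End SmoothCurves.

(** * Foliated hypersurfaces of constant mean curvature *)

Section SphereLevelSet.
Variables (R : realType) (m : nat).
Local Notation point := 'rV[R]_(m.+2 + 1).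
Local Notation tm := (ti m.+1).
Variables (M U0 : set point) (J : set R) (c : 'I_m.+2 -> R -> R) (rho : R -> R).
Hypotheses (oJ : open J) (cJ : forall j, smooth_curve_on J (c j)).
Hypothesis rhoJ : smooth_curve_on J rho.
Hypotheses (oU0 : open U0) (U0H : forall w, U0 w -> 0 < hgt w).
Hypothesis (U0J : forall w, U0 w -> J (w 0 tm)).
Hypothesis MU0 : forall w, U0 w -> M w <-> \sum_j offset c j w ^+ 2 = rho (w 0 tm).
Hypothesis rho_gt0 : forall w, U0 w -> 0 < rho (w 0 tm).

Lemma sphere_partial e w i : e ^+ 2 = 1 -> U0 w ->
  partial i (sphere_fun c rho e) w = sphere_D c rho e i w.
Proof. by move=> e2 /U0J Jw; have [_ E] := has_grad_sphere_fun e cJ rhoJ Jw; exact: E. Qed.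

(** Any open [U] inside [U0] is allowed, because the mean curvature can be tested only on a set
    where the defining function induces the chosen normal. *)
Lemma sphere_local_level_set e (U : set point) : e ^+ 2 = 1 -> open U -> U `<=` U0 ->
  local_level_set M U (sphere_fun c rho e).
Proof.
move=> e2 oU UU0; have e0 : e != 0.
  by apply: contra_eq_neq e2 => ->; rewrite expr0n eq_sym oner_eq0.
split=> //.
- by move=> w /UU0/U0H; rewrite /HxR /half_space /= heightE.
- by apply: smooth_onP => k; apply: (Ck_sphere_fun (J := J)) => // w /UU0/U0J.
(* A zero gradient would make all offsets vanish, against [rho > 0]. *)
- move=> w [Mw /UU0 Uw]; apply/eqP => g0.
  have := rho_gt0 Uw; rewrite -((MU0 Uw).1 Mw) big1 ?ltxx// => j _.
  have := grad_xi (sphere_fun c rho e) j (U0H Uw).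
  rewrite g0 mxE sphere_partial// /sphere_D split_xi => /esym/eqP.
  rewrite !mulf_eq0 (negPf e0) pnatr_eq0 orbb (gt_eqF (U0H Uw))/= => /eqP->.
  by rewrite expr0n.
- exists 0; apply/seteqP; split=> w [].
    by move=> Mw Uw; split=> //; rewrite /sphere_fun ((MU0 (UU0 _ Uw)).1 Mw) subrr mulr0.
  move=> Uw /eqP; rewrite /sphere_fun mulf_eq0 (negPf e0)/= subr_eq0 => /eqP Ew.
  by split=> //; apply/(MU0 (UU0 _ Uw)).
Qed.

Let W2 w := sphere_fun_t c rho w ^+ 2 - 4 * rho (w 0 tm) * hgt w ^+ 2.

Lemma sphere_inner_grad e w : e ^+ 2 = 1 -> U0 w -> M w ->
  - inner (@lorentz R m.+1) w (grad (@lorentz R m.+1) (sphere_fun c rho e) w)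
   (grad (@lorentz R m.+1) (sphere_fun c rho e) w) = W2 w.
Proof.
move=> e2 Uw Mw; rewrite inner_gradE; last exact: U0H.
have -> : (fun i => partial i (sphere_fun c rho e) w) = (sphere_D c rho e) ^~ w.
  by apply/funext => i; rewrite sphere_partial.
by rewrite sphere_grad_norm2//; apply/MU0.
Qed.

Lemma spacelike_sphere w : spacelike M -> U0 w -> M w -> 0 < W2 w.
Proof.
move=> sM Uw Mw; have e2 : 1 ^+ 2 = 1 :> R by rewrite expr1n.
rewrite -(sphere_inner_grad e2 Uw Mw) oppr_gt0.
by apply: (sM U0) => //; exact: sphere_local_level_set.
Qed.

(** The sign [e] is isolated as a factor, so changing it reverses the normal. *)
Lemma unit_grad_sphere e w : e ^+ 2 = 1 -> U0 w -> M w ->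
  unit_grad (sphere_fun c rho e) w =
    (e / Num.sqrt (W2 w)) *:
     row_mx (\row_j (hgt w ^+ 2 * (2 * offset c j w))) (- sphere_fun_t c rho w)%:M.
Proof.
move=> e2 Uw Mw; rewrite /unit_grad sphere_inner_grad// [e / _]mulrC -scalerA; congr (_ *: _).
rewrite grad_split; last exact: U0H.
rewrite scale_row_mx; congr row_mx.
  by apply/rowP => j; rewrite !mxE sphere_partial// /sphere_D split_xi; ring.
by rewrite sphere_partial// /sphere_D split_ti scale_scalar_mx mulrN.
Qed.

Lemma cmc_sphere_eq H z : spacelike M -> constant_mean_curvature M H -> U0 z -> M z ->
  W2 z ^+ 3 * (m.+2%:R * H) ^+ 2 =
  4 * hgt z ^+ 2 * (m%:R * c ord_max (z 0 tm) * sphere_fun_t c rho z ^+ 2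
       - 2 * derive1 rho (z 0 tm) * hgt z * sphere_fun_t c rho z
       - 4 * m.+1%:R * c ord_max (z 0 tm) * rho (z 0 tm) * hgt z ^+ 2
       + 2 * rho (z 0 tm) * hgt z * sphere_fun_tt c rho z) ^+ 2.
Proof.
move=> sM [nu [[cnu onu] hmc]] Uz Mz.
have e1 : 1 ^+ 2 = 1 :> R by rewrite expr1n.
(* The sign [e] is chosen to match [nu] at [z].  It still does so near [z]: on
   [M] the time component of [nu] times the time derivative of the defining
   function is continuous and nonzero, and its sign tells the two unit normals
   apart. *)
have [e e2 nuz] : exists2 e, e ^+ 2 = 1 & nu z = - unit_grad (sphere_fun c rho e) z.
  have [|nuz|nuz] := onu U0 (sphere_fun c rho 1) _ z (conj Mz Uz).
  - exact: sphere_local_level_set.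
  - exists (-1); first by rewrite sqrrN.
    rewrite nuz !unit_grad_sphere// ?sqrrN//.
    by rewrite mulN1r scaleNr opprK mul1r.
  - by exists 1.
have W0 w : U0 w -> M w -> 0 < W2 w by exact: spacelike_sphere.
have ugt w : U0 w -> M w -> unit_grad (sphere_fun c rho e) w 0 tm =
    - (Num.sqrt (W2 w))^-1 * sphere_D c rho e tm w.
  move=> Uw Mw; rewrite unit_grad_sphere// mxE row_mxEr mxE eqxx mulr1n /sphere_D split_ti.
  by ring.
(* On [M] the square of the time derivative is at least [W2], which is positive as [M] is
   spacelike. *)
have pos w : U0 w -> M w -> 0 < (Num.sqrt (W2 w))^-1 * sphere_D c rho e tm w ^+ 2.
  move=> Uw Mw; rewrite mulr_gt0 ?invr_gt0 ?sqrtr_gt0 ?W0//.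
  rewrite /sphere_D split_ti exprMn e2 mul1r.
  apply: lt_le_trans (W0 w Uw Mw) _; rewrite /W2 gerBl.
  by rewrite mulr_ge0 ?sqr_ge0// mulr_ge0// ltW// rho_gt0.
have cvg_phi : nu w 0 tm * sphere_D c rho e tm w @[w --> within M (nbhs z)] -->
    nu z 0 tm * sphere_D c rho e tm z.
  apply: cvgM.
    have /subspace_continuousP cnuM := cnu.
    have := cvg_comp _ _ (cnuM z Mz) (@coord_continuous _ _ _ 0 tm (nu z)).
    exact.
  have [dD _] := has_grad_sphere_D e cJ rhoJ tm (U0J Uz).
  apply: cvg_trans (differentiable_continuous dD); apply: cvg_app; exact: cvg_within.
have phiz : 0 < nu z 0 tm * sphere_D c rho e tm z.
  by rewrite nuz mxE ugt// !mulNr opprK -mulrA -expr2 pos.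
have near_phi := cvgr_gt _ cvg_phi _ phiz.
(* Positivity is known near [z] only relative to [M]. Stated as an implication from [M w], it holds
   on a neighborhood in the ambient space, whose interior is open. *)
pose U1 : set point :=
  interior [set w | M w -> 0 < nu w 0 tm * sphere_D c rho e tm w] `&` U0.
have oU1 : open U1 by apply: openI => //; exact: open_interior.
have U1z : U1 z by split=> //; exact: near_phi.
have lU1 : local_level_set M U1 (sphere_fun c rho e).
  by apply: sphere_local_level_set => // w [].
have nuU1 w : (M `&` U1) w -> nu w = - unit_grad (sphere_fun c rho e) w.
  (* If [nu] were the other unit normal at [w], the product in [U1] would be negative. *)
  move=> [Mw U1w]; have [nuw|//] := onu _ _ lU1 w (conj Mw U1w).
  have [/interior_subset/(_ Mw) phiw Uw] := U1w.
  have := pos w Uw Mw; move: phiw; rewrite nuw ugt// !mulNr -mulrA -expr2.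
  by rewrite oppr_gt0 => /lt_trans/[apply]; rewrite ltxx.
rewrite (hmc _ _ lU1 nuU1 z (conj Mz U1z)) sqrrN.
apply: (divergence_sphere cJ rhoJ) => //; last exact: W0.
- by apply: open_nbhs_nbhs; split=> //; exact: U0J.
- exact: U0H.
- exact/MU0.
Qed.

End SphereLevelSet.

(** * Rigidity of a single slice *)

Section SliceRigidity.
Variables (R : realType) (m : nat) (c : 'I_m.+2 -> R -> R) (rho : R -> R).
Local Notation tm := (ti m.+1).
Variables (t H : R).

Lemma mkpoint_xi (x : 'rV[R]_m.+2) j : mkpoint x t 0 (xi j) = x 0 j.
Proof. exact: row_mxEl. Qed.

Lemma mkpoint_ti (x : 'rV[R]_m.+2) : mkpoint x t 0 tm = t.
Proof. by rewrite /mkpoint /ti row_mxEr mxE. Qed.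

(** The sphere is cut by the vertical plane through its center in a horizontal direction [i]; on the
    resulting circle [circle_rigidity] applies. The second conclusion says that
    [c ord_max ^ 2 - rho], later the squared height of the hyperbolic center, is stationary at
    [t]. *)
Lemma slice_rigidity :
  0 < rho t -> 0 < c ord_max t -> rho t < c ord_max t ^+ 2 ->
  (forall z : 'rV[R]_(m.+2 + 1), z 0 tm = t -> 0 < hgt z ->
    \sum_j offset c j z ^+ 2 = rho t ->
    (sphere_fun_t c rho z ^+ 2 - 4 * rho t * hgt z ^+ 2) ^+ 3 * (m.+2%:R * H) ^+ 2 =
    4 * hgt z ^+ 2 * (m%:R * c ord_max t * sphere_fun_t c rho z ^+ 2
       - 2 * derive1 rho t * hgt z * sphere_fun_t c rho z
       - 4 * m.+1%:R * c ord_max t * rho t * hgt z ^+ 2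
       + 2 * rho t * hgt z * sphere_fun_tt c rho z) ^+ 2) ->
  H != 0 \/ (H = 0 /\ (0 < m)%N) ->
  (forall i, i != ord_max -> derive1 (c i) t = 0) /\
  2 * c ord_max t * derive1 (c ord_max) t = derive1 rho t.
Proof.
set a := c ord_max t => rho0 a0 rhoa E Hn.
suff S i : i != ord_max -> - 2 * derive1 (c i) t = 0 /\
    2 * a * derive1 (c ord_max) t - derive1 rho t = 0.
  split=> [i /S[/eqP + _]|].
    by rewrite mulf_eq0 oppr_eq0 pnatr_eq0/= => /eqP.
  (* The dimension is at least two, so [ord0] is a horizontal direction; one such direction gives
     the second equation. *)
  by have [_ /eqP] : _ := S ord0 isT; rewrite subr_eq0 => /eqP.
move=> iM.
pose k := \sum_j derive1 (c j) t ^+ 2.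
(* These are the coefficients of [L] and [K] on the circle, where [offset] is [X] in direction [i],
   [y - a] in height and 0 elsewhere. *)
apply: (@circle_rigidity R m H a (rho t) (derive1 rho t) (- 2 * derive1 (c i) t)
  (- 2 * derive1 (c ord_max) t) (2 * a * derive1 (c ord_max) t - derive1 rho t)
  (- 2 * derive1 (derive1 (c i)) t) (- 2 * derive1 (derive1 (c ord_max)) t)
  (2 * a * derive1 (derive1 (c ord_max)) t + 2 * k - derive1 (derive1 rho) t)) => //
  X y y0 Xy /=.
pose x : 'rV[R]_m.+2 :=
  \row_j (if j == ord_max then y else c j t + (if j == i then X else 0)).
pose z := mkpoint x t.
have zt : z 0 tm = t by exact: mkpoint_ti.
have zy : hgt z = y by rewrite /hgt mkpoint_xi mxE eqxx.
have oE j : offset c j z = if j == ord_max then y - a else if j == i then X else 0.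
  rewrite /offset zt mkpoint_xi mxE; case: ifP => [/eqP->//|_].
  by rewrite addrAC subrr add0r.
have sE (f : 'I_m.+2 -> R) : \sum_j offset c j z * f j = X * f i + (y - a) * f ord_max.
  rewrite (bigD1 i)//= (bigD1 ord_max) 1?eq_sym//= big1 ?addr0.
    by rewrite !oE eqxx (negPf iM) eqxx.
  by move=> j /andP[/negPf ji /negPf jm]; rewrite oE jm ji mul0r.
have zr : \sum_j offset c j z ^+ 2 = rho t.
  by under eq_bigr do rewrite expr2; rewrite sE !oE !eqxx (negPf iM) -Xy !expr2.
have LE : sphere_fun_t c rho z = - 2 * derive1 (c i) t * X +
    (- 2 * derive1 (c ord_max) t * y + (2 * a * derive1 (c ord_max) t - derive1 rho t)).
  by rewrite /sphere_fun_t zt (sE (fun j => derive1 (c j) t)); ring.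
have KE : sphere_fun_tt c rho z = - 2 * derive1 (derive1 (c i)) t * X +
    (- 2 * derive1 (derive1 (c ord_max)) t * y +
     (2 * a * derive1 (derive1 (c ord_max)) t + 2 * k - derive1 (derive1 rho) t)).
  rewrite /sphere_fun_tt zt sumrB (sE (fun j => derive1 (derive1 (c j)) t)) -/k.
  (* Otherwise [ring] compares these derivatives up to conversion. *)
  generalize (derive1 (derive1 (c i)) t) (derive1 (derive1 (c ord_max)) t)
    (derive1 (derive1 rho) t) => u v w.
  by ring.
have zy0 : 0 < hgt z by rewrite zy.
have := E z zt zy0 zr; rewrite zy LE KE => Ez.
by rewrite [RHS]mulrC Ez.
Qed.

End SliceRigidity.

(** * From vanishing derivatives to constancy, and the theorem *)

Lemma interval_derive0_const (R : realType) (I : set R) (f : R -> R) :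
  is_interval I -> (forall t, I t -> derivable f t 1) ->
  (forall t, (interior I) t -> derive1 f t = 0) ->
  forall s t, I s -> I t -> f s = f t.
Proof.
move=> iI df f0.
suff S s t : I s -> I t -> s < t -> f s = f t.
  by move=> s t Is It; have [/S->//|/S->//|->//] := ltgtP s t.
move=> Is It st.
(* The mean value theorem uses the derivative only inside []s, t[], which lies in the interior of
   [I] even if [s] or [t] is an end point. *)
have oI x : x \in `]s, t[ -> (interior I) x.
  move=> xst; apply: (filterS (P := [set` `]s, t[])) => [y|].
    by rewrite /= in_itv/= => /andP[/ltW sy /ltW yt]; apply: (iI s t); rewrite ?sy.
  by apply: open_nbhs_nbhs; split=> //; exact: interval_open.
have fd x : x \in `]s, t[ -> is_derive x 1 f (derive1 f x).
  move=> xst; rewrite derive1E; apply: derivableP; apply: df.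
  by apply: interior_subset; exact: oI.
have fc : {within `[s, t], continuous f}.
  apply: derivable_within_continuous => y; rewrite in_itv/= => yst.
  by apply: df; exact: (iI s t).
have [x /oI/f0 fx0] := MVT st fd fc.
by rewrite fx0 mul0r => /eqP; rewrite subr_eq0 eq_sym => /eqP.
Qed.

Unset Implicit Arguments.
Set Strict Implicit.

(* The dimension n >= 2 of the hyperbolic factor is written m.+2. *)
Theorem theorem3p1 (R : realType) (m : nat) (M : set 'rV[R]_(m.+2 + 1))
    (I : set R) (H : R)
    (hyperM : hypersurface M) (spacelikeM : spacelike M)
    (cmcM : constant_mean_curvature M H)
    (intervalI : is_interval I) (foliatedM : foliated_by_spheres M I)
    (Hn : H != 0 \/ (H = 0 /\ (3 <= m.+2)%N)) :
  rotationally_symmetric M I.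
Proof.
have [MI [J [p [r [oJ IJ sp sr sliceM]]]]] := foliatedM.
(* If [I] is empty, any point of the half-space serves as center. *)
have [[t0 It0]|nI] := pselect (exists t, I t); last first.
  exists (const_mx 1); split; first by rewrite /half_space /height /= mxE.
  by move=> t It; case: nI; exists t.
have dp t j : I t -> derivable (fun t => p t 0 j) t 1.
  have sj : smooth_curve_on J (fun t => p t 0 j) by exact: smooth_curve_coord.
  by move=> /IJ Jt; exact: (sj 0%N _ Jt).
(* If the hyperbolic center is stationary at interior times, it is constant on [I], and its value at
   [t0] gives the axis. *)
suff dp0 t j : (interior I) t -> derive1 (fun t => p t 0 j) t = 0.
  have pE t : I t -> p t = p t0.
    move=> It; apply/rowP => j.
    apply: (interval_derive0_const intervalI (f := fun t => p t 0 j)) => // s.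
      exact: dp.
    exact: dp0.
  have [hp0 _ _] := sliceM t0 It0.
  exists (p t0); split=> // t It; have [_ rt sE] := sliceM t It.
  by exists (r t) => //; rewrite sE pE.
move=> It; pose c (k : 'I_m.+2) (s : R) := euclidean_center (p s) (r s) k.
pose rho (s : R) := (height (p s) * sinh (r s)) ^+ 2.
have cJ k : smooth_curve_on J (c k) by exact: smooth_curve_center.
have rhoJ : smooth_curve_on J rho by exact: smooth_curve_radius2.
have Jt : J t by apply: IJ; exact: interior_subset.
have rho0 s : I s -> 0 < rho s.
  by move=> Is; have [hp rs _] := sliceM s Is; rewrite exprn_gt0// mulr_gt0// sinh_gt0.
have cmaxE s : c ord_max s = height (p s) * cosh (r s).
  by rewrite /c /euclidean_center eqxx.
have hE s : c ord_max s ^+ 2 - rho s = height (p s) ^+ 2.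
  by rewrite cmaxE /rho -[RHS]mulr1 -(cosh2_sub_sinh2 (r s)); ring.
pose tm := ti m.+1.
(* Only interior times are kept: this makes [U0] open, and each time occurring in it still belongs
   to one of the given spheres. *)
pose U0 : set 'rV[R]_(m.+2 + 1) :=
  [set w | 0 < hgt w] `&` [set w | (interior I) (w 0 tm)].
have oU0 : open U0.
  have oc (k : 'I_(m.+2 + 1)) (A : set R) :
      open A -> open [set w : 'rV[R]_(m.+2 + 1) | A (w 0 k)].
    move=> oA; apply: (open_comp (f := fun w : 'rV[R]_(m.+2 + 1) => w 0 k)) oA => w _.
    exact: coord_continuous.
  exact: openI (oc (xi ord_max) _ (@open_gt R 0)) (oc tm _ (@open_interior _ I)).
have MU0 w : U0 w -> M w <-> \sum_j offset c j w ^+ 2 = rho (w 0 tm).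
  move=> [w0 /interior_subset Iw]; have [hp rs sE] := sliceM _ Iw.
  have -> : M w <-> slice M (w 0 tm) (space_part w).
    rewrite /slice /= /mkpoint (_ : row_mx _ _ = w)//.
    rewrite -[RHS]hsubmxK; congr row_mx; apply/matrixP => i k.
    by rewrite !mxE !ord1.
  rewrite sE geodesic_sphereE//.
  have -> : \sum_j (space_part w 0 j - euclidean_center (p (w 0 tm)) (r (w 0 tm)) j) ^+ 2
    = \sum_j offset c j w ^+ 2 by apply: eq_bigr => k _; rewrite space_partE.
  split=> [[]//|]; split=> //.
  by rewrite /half_space /= heightE.
have hpt : 0 < height (p t) by have [] := sliceM t (interior_subset It).
have [||||ci cm] := @slice_rigidity R m c rho t H (rho0 t (interior_subset It)).
- by rewrite cmaxE mulr_gt0// cosh_gt0.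
- by rewrite -subr_gt0 hE exprn_gt0.
- move=> z zt z0 zr.
  have U0z : U0 z by split=> //; rewrite /= zt.
  have Mz : M z by apply/(MU0 _ U0z); rewrite zt.
  have U0H w : U0 w -> 0 < hgt w by case.
  have U0J w : U0 w -> J (w 0 tm) by move=> [_ /interior_subset/IJ].
  have U0rho w : U0 w -> 0 < rho (w 0 tm) by move=> [_ /interior_subset/rho0].
  have := cmc_sphere_eq oJ cJ rhoJ oU0 U0H U0J MU0 U0rho spacelikeM cmcM U0z Mz.
  by rewrite zt.
(* [3 <= m.+2] and [0 < m] agree by computation. *)
- by case: Hn => [|[-> m3]]; [left|right].
have [->|jM] := eqVneq j ord_max; last first.
  by rewrite -(ci j jM); congr (derive1 _ t); apply/funext => s;
     rewrite /c /euclidean_center (negPf jM).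
(* For the vertical coordinate, [height (p s) ^ 2] is differentiated in two ways: directly, and as
   [c ord_max ^ 2 - rho], where [cm] gives 0. As the height is positive, its derivative vanishes. *)
have dh : is_derive t 1 (fun s => height (p s)) (derive1 (fun s => p s 0 ord_max) t).
  by rewrite derive1E; apply: derivableP; apply: dp; exact: interior_subset.
have dc := smooth_curve_is_derive (cJ ord_max) Jt.
have drho := smooth_curve_is_derive rhoJ Jt.
have d2 : is_derive t 1 (fun s => height (p s) ^+ 2)
    (2 * height (p t) * derive1 (fun s => p s 0 ord_max) t).
  apply: is_derive_eq (is_deriveX 2 dh) _.
  by rewrite expr1.
have d2' : is_derive t 1 (fun s => height (p s) ^+ 2)
    (2 * c ord_max t * derive1 (c ord_max) t - derive1 rho t).
  have -> : (fun s => height (p s) ^+ 2) = (c ord_max) ^+ 2 - rho.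
    by apply/funext => s; rewrite -hE.
  apply: is_derive_eq (is_deriveB (is_deriveX 2 dc) drho) _.
  by rewrite expr1.
have := @derive_val _ _ _ _ _ _ _ d2; rewrite (@derive_val _ _ _ _ _ _ _ d2') cm subrr.
move=> /esym/eqP; rewrite !mulf_eq0 pnatr_eq0 (gt_eqF hpt)/= => /eqP //.
Qed.
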